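(* Let $\Phi=(G,\varphi)$ be a connected $\mathbb{T}$-gain graph and $<$ a total order on $V(G)$. The following are equivalent: (i) $\Phi$ is balanced; (ii) the complete $\mathbb{T}$-gain graph $K^{D^{\max}_{<}}(\Phi)$ is balanced; (iii) the complete $\mathbb{T}$-gain graph $K^{D^{\min}_{<}}(\Phi)$ is balanced; (iv) $D^{\max}_{<}(\Phi)=D^{\min}_{<}(\Phi)$ and the complete $\mathbb{T}$-gain graph $K^{D}(\Phi):=K^{D^{\max}_{<}}(\Phi)=K^{D^{\min}_{<}}(\Phi)$ is balanced.
   Context: $\mathbb{T}=\{z\in\mathbb{C}:|z|=1\}$. A $\mathbb{T}$-gain graph $\Phi=(G,\varphi)$ on a simple graph $G$ with vertices $v_1,\dots,v_n$ assigns to each oriented edge $\overrightarrow{e}_{i,j}$ an element $\varphi(\overrightarrow{e}_{i,j})\in\mathbb{T}$ with $\varphi(\overrightarrow{e}_{j,i})=\varphi(\overrightarrow{e}_{i,j})^{-1}$. The gain of an oriented path or cycle is the product of the gains of its consecutive oriented edges; $\Phi$ is balanced if every cycle has gain $1$. $d(s,t)$ is the graph distance. $\mathcal{P}(s,t)$ is the set of oriented shortest paths from $s$ to $t$; $\mathcal{P}^{\max}(s,t)$ (resp. $\mathcal{P}^{\min}(s,t)$) is the set of those whose gain has maximum (resp. minimum) real part in $\mathcal{P}(s,t)$. For $s<t$, $\varphi^{<}_{\max}(s,t)$ is the gain of a path in $\mathcal{P}^{\max}(s,t)$ with maximum imaginary part of gain among paths in $\mathcal{P}^{\max}(s,t)$,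 and $\varphi^{<}_{\max}(t,s)=\overline{\varphi^{<}_{\max}(s,t)}$; $\varphi^{<}_{\min}(s,t)$ is the gain of a path in $\mathcal{P}^{\min}(s,t)$ with minimum imaginary part of gain among paths in $\mathcal{P}^{\min}(s,t)$, and $\varphi^{<}_{\min}(t,s)=\overline{\varphi^{<}_{\min}(s,t)}$. $D^{\max}_{<}(\Phi)=(\varphi^{<}_{\max}(v_i,v_j)d(v_i,v_j))$, $D^{\min}_{<}(\Phi)=(\varphi^{<}_{\min}(v_i,v_j)d(v_i,v_j))$. The complete $\mathbb{T}$-gain graph $K^{D^{\max}_{<}}(\Phi)$ is obtained from $\Phi$ by keeping its edges and gains and joining each non-adjacent pair $v_i,v_j$ by an edge with gain $\varphi(\overrightarrow{e}_{i,j})=\varphi^{<}_{\max}(v_i,v_j)$; $K^{D^{\min}_{<}}(\Phi)$ is defined likewise with $\varphi^{<}_{\min}$. *)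

(* Defs.v *)
From HB Require Import structures.
From mathcomp Require Import all_boot all_order all_algebra.
From mathcomp Require Import complex reals.

Set Implicit Arguments.
Unset Strict Implicit.
Unset Printing Implicit Defensive.

Import Order.TTheory GRing.Theory Num.Theory.
Local Open Scope ring_scope.
Local Open Scope complex_scope.

Record strict_total_order (T : Type) := StrictTotalOrder {
  sto_lt :> rel T;
  sto_irr : irreflexive sto_lt;
  sto_trans : transitive sto_lt;
  sto_total : forall x y, x <> y -> sto_lt x y || sto_lt y x
}.

(* The value of [gain] on non-adjacent pairs is irrelevant. *)
Record gain_graph (R : realType) (T : finType) := GainGraph {
  adj : rel T;
  adj_sym : symmetric adj;
  adj_irr : irreflexive adj;
  gain : T -> T -> R[i];
  gain_norm : forall x y, adj x y -> `|gain x y| = 1;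
  gain_inv : forall x y, adj x y -> gain y x = (gain x y)^-1
}.

Section GainGraph.
Variables (R : realType) (T : finType).
Implicit Types (G : gain_graph R T) (s t : T) (p c : seq T).

Definition connected G := forall s t, connect (adj G) s t.

(* [is_path G s t p] : [s :: p] is a path from [s] to [t]; its length is
   [size p]. *)
Definition is_path G s t p :=
  [&& path (adj G) s p, last s p == t & uniq (s :: p)].

Definition path_gain G s p : R[i] := \prod_(z <- pairmap (gain G) s p) z.

(* [c = [:: c_0; ...; c_k]] stands for the closed walk c_0, ..., c_k, c_0. *)
Definition is_cycle G c := [&& 2 < size c, cycle (adj G) c & uniq c]%N.

Definition cycle_gain G c : R[i] :=
  if c is x :: p then path_gain G x (rcons p x) else 1.

Definition balanced G := forall c, is_cycle G c -> cycle_gain G c = 1.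

(* Least length of a path from [s] to [t], or [#|T|] if there is none. *)
Definition dist G s t : nat :=
  find (fun k => [exists p : k.-tuple T, is_path G s t p]) (iota 0 #|T|).

Definition shortest_paths G s t : {set (dist G s t).-tuple T} :=
  [set p : (dist G s t).-tuple T | is_path G s t p].

Definition shortest_max G s t : {set (dist G s t).-tuple T} :=
  [set p in shortest_paths G s t |
    [forall q in shortest_paths G s t,
      complex.Re (path_gain G s q) <= complex.Re (path_gain G s p)]].

Definition shortest_min G s t : {set (dist G s t).-tuple T} :=
  [set p in shortest_paths G s t |
    [forall q in shortest_paths G s t,
      complex.Re (path_gain G s p) <= complex.Re (path_gain G s q)]].

(* The default value 1 is only reached when there is no path from [s] to [t].
   The picked path is not unique, but its gain is. *)
Definition best_max G s t : R[i] :=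
  if [pick p in shortest_max G s t |
       [forall q in shortest_max G s t,
         complex.Im (path_gain G s q) <= complex.Im (path_gain G s p)]]
  is Some p then path_gain G s p else 1.

Definition best_min G s t : R[i] :=
  if [pick p in shortest_min G s t |
       [forall q in shortest_min G s t,
         complex.Im (path_gain G s p) <= complex.Im (path_gain G s q)]]
  is Some p then path_gain G s p else 1.

Definition phi_max G (lt : strict_total_order T) s t : R[i] :=
  if lt t s then (best_max G t s)^* else best_max G s t.

Definition phi_min G (lt : strict_total_order T) s t : R[i] :=
  if lt t s then (best_min G t s)^* else best_min G s t.

Lemma path_gain_norm G s p : path (adj G) s p -> `|path_gain G s p| = 1.
Proof.
elim: p s => [|x p IH] s /=; first by rewrite /path_gain big_nil normr1.
case/andP=> asx pxp.
by rewrite /path_gain /= big_cons normrM gain_norm // mul1r IH.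
Qed.

Lemma best_max_norm G s t : `|best_max G s t| = 1.
Proof.
rewrite /best_max; case: pickP => [p|_]; last by rewrite normr1.
rewrite !inE => /andP[/andP[/and3P[+ _ _] _] _].
exact: path_gain_norm.
Qed.

Lemma best_min_norm G s t : `|best_min G s t| = 1.
Proof.
rewrite /best_min; case: pickP => [p|_]; last by rewrite normr1.
rewrite !inE => /andP[/andP[/and3P[+ _ _] _] _].
exact: path_gain_norm.
Qed.

Lemma conj_normE (z : R[i]) : `|z| = 1 -> z^* = z^-1.
Proof. by move=> z1; rewrite invC_norm z1 expr1n invr1 mul1r. Qed.

Lemma orient_norm (f : T -> T -> R[i]) (lt : strict_total_order T) s t :
  (forall s t, `|f s t| = 1) ->
  `|if lt t s then (f t s)^* else f s t| = 1.
Proof. by move=> f1; case: ifP => // _; rewrite norm_conjC. Qed.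

Lemma orient_inv (f : T -> T -> R[i]) (lt : strict_total_order T) s t :
  (forall s t, `|f s t| = 1) -> s != t ->
  (if lt s t then (f s t)^* else f t s) =
  (if lt t s then (f t s)^* else f s t)^-1.
Proof.
move=> f1 /eqP nst; have := sto_total lt nst.
case: (boolP (lt s t)) => [st _|_ /= ->]; last first.
  by rewrite conj_normE // invrK.
case: (boolP (lt t s)) => [ts|_]; last exact: conj_normE.
by have := sto_trans st ts; rewrite sto_irr.
Qed.

Lemma phi_max_norm G lt s t : `|phi_max G lt s t| = 1.
Proof. exact/orient_norm/best_max_norm. Qed.

Lemma phi_min_norm G lt s t : `|phi_min G lt s t| = 1.
Proof. exact/orient_norm/best_min_norm. Qed.

Lemma phi_max_inv G lt s t :
  s != t -> phi_max G lt t s = (phi_max G lt s t)^-1.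
Proof. exact/orient_inv/best_max_norm. Qed.

Lemma phi_min_inv G lt s t :
  s != t -> phi_min G lt t s = (phi_min G lt s t)^-1.
Proof. exact/orient_inv/best_min_norm. Qed.

Section Complete.
Variables (G : gain_graph R T) (f : T -> T -> R[i]).
Hypothesis f_norm : forall s t, `|f s t| = 1.
Hypothesis f_inv : forall s t, s != t -> f t s = (f s t)^-1.

Definition complete_adj : rel T := fun s t => s != t.
Definition complete_gain s t : R[i] := if adj G s t then gain G s t else f s t.

Lemma complete_adj_sym : symmetric complete_adj.
Proof. by move=> s t; rewrite /complete_adj eq_sym. Qed.

Lemma complete_adj_irr : irreflexive complete_adj.
Proof. by move=> s; rewrite /complete_adj eqxx. Qed.

Lemma complete_gain_norm s t : complete_adj s t -> `|complete_gain s t| = 1.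
Proof. by rewrite /complete_gain; case: ifP => // /gain_norm. Qed.

Lemma complete_gain_inv s t :
  complete_adj s t -> complete_gain t s = (complete_gain s t)^-1.
Proof.
rewrite /complete_gain adj_sym; case: ifP => [/gain_inv//|_].
exact: f_inv.
Qed.

Definition complete_graph : gain_graph R T :=
  GainGraph complete_adj_sym complete_adj_irr
    complete_gain_norm complete_gain_inv.
End Complete.

Definition K_max G (lt : strict_total_order T) : gain_graph R T :=
  complete_graph G (phi_max_norm G lt) (phi_max_inv G lt).

Definition K_min G (lt : strict_total_order T) : gain_graph R T :=
  complete_graph G (phi_min_norm G lt) (phi_min_inv G lt).

End GainGraph.

Definition D_max (R : realType) (n : nat) (G : gain_graph R 'I_n)
    (lt : strict_total_order 'I_n) : 'M[R[i]]_n :=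
  \matrix_(i, j) (phi_max G lt i j * (dist G i j)%:R).

Definition D_min (R : realType) (n : nat) (G : gain_graph R 'I_n)
    (lt : strict_total_order 'I_n) : 'M[R[i]]_n :=
  \matrix_(i, j) (phi_min G lt i j * (dist G i j)%:R).

(* Main.v *)
Require Import Defs.
From mathcomp Require Import all_boot all_order all_algebra.
From mathcomp Require Import complex reals boolp.

(** In a balanced gain graph every closed walk has gain 1, because cutting a
    closed walk at a repeated vertex leaves shorter closed walks; hence the gain
    of a walk depends only on its endpoints.  Both phi_max(s, t) and
    phi_min(s, t) are gains of walks from s to t, so they coincide, and every
    cycle of the completed graph has the gain of a closed walk of the original
    one.  Conversely, a cycle of the original graph is a cycle with the same
    gain in either completion. *)

Set Implicit Arguments.
Unset Strict Implicit.
Unset Printing Implicit Defensive.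

Import Order.TTheory GRing.Theory Num.Theory.
Local Open Scope ring_scope.

Lemma has_dup_split (T : eqType) (s : seq T) :
  ~~ uniq s -> exists x p q r, s = p ++ x :: q ++ x :: r.
Proof.
elim: s => //= y s IH; rewrite negb_and negbK => /orP[ys|/IH].
  by case/splitPr: ys => q r; exists y, [::], q, r.
by case=> x [p [q [r ->]]]; exists x, (y :: p), q, r.
Qed.

Section Walks.
Variables (R : realType) (T : finType).
Implicit Types (G : gain_graph R T) (s t : T) (p q c : seq T) (z : R[i]).

Lemma path_gain_nil G s : path_gain G s [::] = 1.
Proof. by rewrite /path_gain big_nil. Qed.

Lemma path_gain_cons G s x p :
  path_gain G s (x :: p) = gain G s x * path_gain G x p.
Proof. by rewrite /path_gain /= big_cons. Qed.

Lemma path_gain_cat G s p q :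
  path_gain G s (p ++ q) = path_gain G s p * path_gain G (last s p) q.
Proof. by rewrite /path_gain pairmap_cat big_cat. Qed.

Lemma gain_neq0 G s t : adj G s t -> gain G s t != 0.
Proof. by move/gain_norm=> n1; rewrite -normr_eq0 n1 oner_eq0. Qed.

(** Strong induction on the length. Since [is_cycle] demands at least three vertices, short walks
    are separate: length 1 would be a loop, and length 2 goes along an edge and back. *)
Lemma balanced_closed_walk G s p :
  balanced G -> path (adj G) s p -> last s p = s -> path_gain G s p = 1.
Proof.
move=> balG; have [m] := ubnP (size p); elim: m s p => // m IH s p.
rewrite ltnS => szp pth lst.
(* Repetitions are sought in [p], not in [s :: p], because [s] always recurs as the last vertex of a
   nonempty [p]. *)
have [up|/has_dup_split[x [p1 [p2 [p3 Ep]]]]] := boolP (uniq p).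
  case/lastP: p => [|q y] in szp pth lst up *; first by rewrite path_gain_nil.
  rewrite last_rcons in lst; subst y.
  case: q => [|a [|b q]] in szp pth up *.
  - by move: pth; rewrite /= adj_irr.
  - move: pth => /= /and3P[sa _ _].
    rewrite !path_gain_cons path_gain_nil mulr1 (gain_inv sa).
    by rewrite divff ?gain_neq0.
  - apply: (balG [:: s, a, b & q]); apply/and3P; split=> //.
    exact: etrans (esym (rcons_uniq [:: a, b & q] s)) up.
move: pth lst szp.
(* The walk runs from [s] to [x], around a loop at [x], and back to [s]. The loop and the walk
   without it are both strictly shorter, since [rcons p1 x] and [rcons p2 x] are nonempty. *)
have {p Ep}-> : p = rcons p1 x ++ rcons p2 x ++ p3 by rewrite Ep !cat_rcons.
rewrite !cat_path !last_cat !last_rcons.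
case/and3P=> pth1 pth2 pth3 lst3 szp.
rewrite !path_gain_cat !last_rcons.
have -> : path_gain G x (rcons p2 x) = 1.
  apply: IH => //; last by rewrite last_rcons.
  apply: leq_trans szp; rewrite !size_cat !size_rcons addSn ltnS.
  exact: leq_trans (leq_addr _ _) (leq_addl _ _).
rewrite mul1r.
have := IH s (rcons p1 x ++ p3); rewrite path_gain_cat last_rcons; apply.
- apply: leq_trans szp; rewrite !size_cat !size_rcons ltn_add2l.
  by rewrite addSn ltnS leq_addl.
- by rewrite cat_path last_rcons pth1.
- by rewrite last_cat last_rcons.
Qed.

(** Forgets the walk and keeps only its endpoints and gain, so that concatenation and reversal
    become multiplication and inversion. *)
Definition walk_gain G s t z :=
  exists p, [/\ path (adj G) s p, last s p = t & path_gain G s p = z].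

Lemma walk_gain_refl G s : walk_gain G s s 1.
Proof. by exists [::]; rewrite path_gain_nil. Qed.

Lemma walk_gain_edge G s t : adj G s t -> walk_gain G s t (gain G s t).
Proof.
move=> st; exists [:: t].
by rewrite /= st path_gain_cons path_gain_nil mulr1.
Qed.

Lemma walk_gain_trans G s t u z w :
  walk_gain G s t z -> walk_gain G t u w -> walk_gain G s u (z * w).
Proof.
move=> [p [pp lp <-]] [q [pq lq <-]]; exists (p ++ q).
by rewrite cat_path last_cat path_gain_cat lp pp pq lq.
Qed.

Lemma walk_gain_neq0 G s t z : walk_gain G s t z -> z != 0.
Proof.
by move=> [p [/path_gain_norm n1 _ <-]]; rewrite -normr_eq0 n1 oner_eq0.
Qed.

Lemma walk_gain_inv G s t z : walk_gain G s t z -> walk_gain G t s z^-1.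
Proof.
case=> p [pp <- <-] {t z}.
elim: p s pp => [|x p IH] s /=.
  by rewrite path_gain_nil invr1 => _; apply: walk_gain_refl.
(* The reversed walk takes the reversed tail first and the edge from [x] to [s] last; commutativity
   puts the factors in that order. *)
case/andP=> sx /IH wx; rewrite path_gain_cons invfM mulrC.
apply: walk_gain_trans wx _; rewrite -gain_inv //.
by apply: walk_gain_edge; rewrite adj_sym.
Qed.

(** One walk followed by the reverse of the other is closed and has gain [z * w^-1]. *)
Lemma walk_gain_unique G s t z w : balanced G ->
  walk_gain G s t z -> walk_gain G s t w -> z = w.
Proof.
move=> balG wz ww; have w0 := walk_gain_neq0 ww.
have [p [pp lp gp]] := walk_gain_trans wz (walk_gain_inv ww).
by apply: (divIf w0); rewrite divff // -gp balanced_closed_walk.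
Qed.

(** A connecting walk shortens to a simple path, whose length is below [#|T|]; hence the search in
    [dist] succeeds and does not return its default [#|T|]. *)
Lemma shortest_paths_exist G s t : connected G ->
  exists p : (dist G s t).-tuple T, p \in shortest_paths G s t.
Proof.
move=> conn; have /connectP[p pp lp] := conn s t.
have [q [qp uq lq]] :
    exists q, [/\ path (adj G) s q, uniq (s :: q) & last s q = t].
  by case/shortenP: pp lp => q pq uq _ ->; exists q.
have has_len : has (fun k => [exists p : k.-tuple T, is_path G s t p])
                   (iota 0 #|T|).
  apply/hasP; exists (size q).
    by rewrite mem_iota /= add0n; have := max_card (mem (s :: q));
      rewrite (card_uniqP uq).
  by apply/existsP; exists (in_tuple q); rewrite /is_path qp lq eqxx.
have := nth_find 0%N has_len; rewrite nth_iota ?add0n; last first.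
  by move: has_len; rewrite has_find size_iota.
by case/existsP=> r Hr; exists r; rewrite inE.
Qed.

Lemma walk_gain_shortest G s t (p : (dist G s t).-tuple T) :
  p \in shortest_paths G s t -> walk_gain G s t (path_gain G s p).
Proof. by rewrite inE => /and3P[pp /eqP lp _]; exists p. Qed.

Lemma walk_gain_best_max G s t : connected G -> walk_gain G s t (best_max G s t).
Proof.
move=> conn; have [p0 Hp0] := shortest_paths_exist s t conn.
rewrite /best_max; case: pickP => [p|none].
  by rewrite inE => /andP[/andP[/walk_gain_shortest]].
(* The default value 1 is impossible: maximising the real part, then the imaginary part among the
   maximisers, yields a path that [pick] would accept. *)
have [p1 Hp1 max1] := arg_maxP (fun p : (dist G s t).-tuple T =>
  complex.Re (path_gain G s p)) Hp0.
have Hm1 : p1 \in shortest_max G s t.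
  by rewrite inE; apply/andP; split=> //; apply/forall_inP.
have [p2 Hp2 max2] := arg_maxP (fun p : (dist G s t).-tuple T =>
  complex.Im (path_gain G s p)) Hm1.
have := none p2; rewrite [X in X && _]Hp2 /=.
by move/negP; case; apply/forall_inP.
Qed.

Lemma walk_gain_best_min G s t : connected G -> walk_gain G s t (best_min G s t).
Proof.
move=> conn; have [p0 Hp0] := shortest_paths_exist s t conn.
rewrite /best_min; case: pickP => [p|none].
  by rewrite inE => /andP[/andP[/walk_gain_shortest]].
have [p1 Hp1 min1] := arg_minP (fun p : (dist G s t).-tuple T =>
  complex.Re (path_gain G s p)) Hp0.
have Hm1 : p1 \in shortest_min G s t.
  by rewrite inE; apply/andP; split=> //; apply/forall_inP.
have [p2 Hp2 min2] := arg_minP (fun p : (dist G s t).-tuple T =>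
  complex.Im (path_gain G s p)) Hm1.
have := none p2; rewrite [X in X && _]Hp2 /=.
by move/negP; case; apply/forall_inP.
Qed.

Lemma walk_gain_phi_max G lt s t :
  connected G -> walk_gain G s t (phi_max G lt s t).
Proof.
move=> conn; rewrite /phi_max; case: ifP => _; last exact: walk_gain_best_max.
rewrite conj_normE ?best_max_norm //.
exact/walk_gain_inv/walk_gain_best_max.
Qed.

Lemma walk_gain_phi_min G lt s t :
  connected G -> walk_gain G s t (phi_min G lt s t).
Proof.
move=> conn; rewrite /phi_min; case: ifP => _; last exact: walk_gain_best_min.
rewrite conj_normE ?best_min_norm //.
exact/walk_gain_inv/walk_gain_best_min.
Qed.

Lemma phi_max_min G lt : connected G -> balanced G ->
  phi_max G lt = phi_min G lt.
Proof.
move=> conn balG; apply/funext => s; apply/funext => t.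
exact: walk_gain_unique balG (walk_gain_phi_max lt s t conn)
  (walk_gain_phi_min lt s t conn).
Qed.

Section Complete.
Variables (G : gain_graph R T) (f : T -> T -> R[i]).
Hypothesis f_norm : forall s t, `|f s t| = 1.
Hypothesis f_inv : forall s t, s != t -> f t s = (f s t)^-1.
Let K := complete_graph G f_norm f_inv.

(** Each added edge of [K] is replaced by a walk of [G] with the same endpoints and gain. *)
Lemma complete_graph_walk_gain s p : (forall s t, walk_gain G s t (f s t)) ->
  walk_gain G s (last s p) (path_gain K s p).
Proof.
move=> wf; elim: p s => [|x p IH] s.
  by rewrite path_gain_nil; apply: walk_gain_refl.
rewrite path_gain_cons; apply: walk_gain_trans (IH x).
by rewrite /= /complete_gain; case: ifP => [/walk_gain_edge|].
Qed.

Lemma balanced_complete_graph : (forall s t, walk_gain G s t (f s t)) ->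
  balanced G -> balanced K.
Proof.
move=> wf balG [|x p] // _.
apply: walk_gain_unique balG _ (walk_gain_refl G x).
by have := complete_graph_walk_gain x (rcons p x) wf; rewrite last_rcons.
Qed.

Lemma complete_graph_path_gain s p :
  path (adj G) s p -> path_gain K s p = path_gain G s p.
Proof.
elim: p s => [|x p IH] s /=; first by rewrite !path_gain_nil.
by case/andP=> sx /IH; rewrite !path_gain_cons /= /complete_gain sx => ->.
Qed.

Lemma balanced_of_complete_graph : balanced K -> balanced G.
Proof.
move=> balK [|x p] // /and3P[sz cyc un].
rewrite /= -complete_graph_path_gain //; apply: (balK (x :: p)).
rewrite /is_cycle sz un andbT /=; apply: sub_path cyc => y w yw.
by rewrite /= /complete_adj; apply: contraTneq yw => ->; rewrite adj_irr.
Qed.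

End Complete.

(** The graphs also store proofs about [f] and [g]; these are identified by proof irrelevance. *)
Lemma eq_complete_graph G f g fn fi gn gi : f = g ->
  @complete_graph R T G f fn fi = @complete_graph R T G g gn gi.
Proof.
move=> fg; case: g / fg gn gi => gn gi.
by rewrite (Prop_irrelevance fn gn) (Prop_irrelevance fi gi).
Qed.

End Walks.

Theorem theorem5p3 (R : realType) (n : nat) (Phi : gain_graph R 'I_n)
    (lt : strict_total_order 'I_n) (conn : connected Phi) :
  [<-> balanced Phi;
       balanced (K_max Phi lt);
       balanced (K_min Phi lt);
       [/\ D_max Phi lt = D_min Phi lt,
           K_max Phi lt = K_min Phi lt
         & balanced (K_max Phi lt)]].
Proof.
have toMax : balanced Phi -> balanced (K_max Phi lt).
  by apply: balanced_complete_graph => s t; apply: walk_gain_phi_max.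
have toMin : balanced Phi -> balanced (K_min Phi lt).
  by apply: balanced_complete_graph => s t; apply: walk_gain_phi_min.
(* Each remaining implication first recovers balance of [Phi] from that of a completion. *)
tfae=> //.
- by move/balanced_of_complete_graph.
- move/balanced_of_complete_graph=> bal; have eq_phi := phi_max_min lt conn bal.
  split; last exact: toMax.
    by apply/matrixP => i j; rewrite !mxE eq_phi.
  exact: eq_complete_graph.
- by case=> _ _ /balanced_of_complete_graph.
Qed.
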